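(* Let $\mathcal{A}$ be a finite (possibly nonabelian) group and let $\Phi:\mathcal{A}^{\mathbb{N}}\to\mathcal{A}^{\mathbb{N}}$ be the nearest neighbour multiplication cellular automaton, $\Phi(\mathbf{a})_n=a_n\cdot a_{n+1}$. If $\mu$ is a $\sigma$-invariant and $\Phi$-ergodic Borel probability measure on $\mathcal{A}^{\mathbb{N}}$, then there is a subgroup $\mathcal{C}$ of $\mathcal{A}$ such that $\mu$ is a $\mathcal{C}$-measure.
   Context: $\mathbb{N}=\{0,1,2,\ldots\}$ and $\widetilde{\mathbb{N}}=\{1,2,3,\ldots\}$. $\mathcal{A}$ is discrete and $\mathcal{A}^{\mathbb{N}}$ carries the product topology. $\sigma$ is the shift on $\mathcal{A}^{\mathbb{N}}$, $\sigma(\mathbf{a})_n=a_{n+1}$. ''$\Phi$-ergodic'' means $\Phi$-invariant and ergodic for $\Phi$. Conditional measures: let $\widetilde\mu$ be the projection of $\mu$ to $\mathcal{A}^{\widetilde{\mathbb{N}}}$. For $\mathbf{a}\in\mathcal{A}^{\widetilde{\mathbb{N}}}$ let $\mu_{\mathbf{a}}$ be the conditional probability measure on $\mathcal{A}$ given by $\mu_{\mathbf{a}}(b)=\mu[x_0=b \mid \mathbf{x}|_{\widetilde{\mathbb{N}}}=\mathbf{a}]$, where $\mathbf{x}\in\mathcal A^{\mathbb N}$ is $\mu$-random (defined for $\widetilde\mu$-almost every $\mathbf{a}$), so that $\mu=\int (\mu_{\mathbf{a}}\otimes\delta_{\mathbf{a}})\,d\widetilde\mu[\mathbf{a}]$.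 For a subgroup $\mathcal{C}$ of $\mathcal{A}$ (the trivial subgroup and $\mathcal{A}$ itself are allowed), $\mu$ is called a $\mathcal{C}$-measure if, for $\widetilde\mu$-almost every $\mathbf{a}\in\mathcal{A}^{\widetilde{\mathbb{N}}}$, the support of $\mu_{\mathbf{a}}$ is a right coset $\mathcal{C}b$ of $\mathcal{C}$ and $\mu_{\mathbf{a}}$ is uniformly distributed on this coset. *)

(* Defs.v *)
From HB Require Import structures.
From mathcomp Require Import all_boot all_order all_algebra all_fingroup.
From mathcomp Require Import all_classical all_reals all_analysis.

Set Implicit Arguments.
Unset Strict Implicit.
Unset Printing Implicit Defensive.

Local Open Scope classical_set_scope.
Local Open Scope ring_scope.
Local Open Scope ereal_scope.

(* An alias of the finite group, so that it can carry the discrete topology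
   and its Borel sigma-algebra. The base point is only there because the
   library's measurable types are pointed. *)
Definition alphabet (A : finGroupType) : Type := A.

HB.instance Definition _ (A : finGroupType) := Finite.on (alphabet A).
HB.instance Definition _ (A : finGroupType) :=
  isPointed.Build (alphabet A) (1%g : A).
HB.instance Definition _ (A : finGroupType) :=
  hasNbhs.Build (alphabet A) principal_filter.
HB.instance Definition _ (A : finGroupType) :=
  Discrete_ofNbhs.Build (alphabet A) erefl.
HB.instance Definition _ (A : finGroupType) :=
  @isMeasurable.Build (sigma_display (@open (alphabet A)))
    (alphabet A) <<s @open (alphabet A) >>
    (@sigma_algebra0 _ setT _) (@sigma_algebraC _ _)
    (@sigma_algebra_bigcup _ setT _).

(* I -> A with the product topology and its Borel sigma-algebra *)
Definition config (I : Type) (A : finGroupType) : Type :=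
  {ptws I -> alphabet A}.

HB.instance Definition _ (I : Type) (A : finGroupType) :=
  Topological.on (config I A).
HB.instance Definition _ (I : Type) (A : finGroupType) :=
  isPointed.Build (config I A) (fun=> (1%g : A)).
HB.instance Definition _ (I : Type) (A : finGroupType) :=
  @isMeasurable.Build (sigma_display (@open (config I A)))
    (config I A) <<s @open (config I A) >>
    (@sigma_algebra0 _ setT _) (@sigma_algebraC _ _)
    (@sigma_algebra_bigcup _ setT _).

Definition posnat : Type := {n : nat | (0 < n)%N}.

Section dynamics.
Context d (X : measurableType d) (R : realType).

Definition invariant_measure (T : X -> X) (mu : probability X R) : Prop :=
  forall B : set X, measurable B -> mu (T @^-1` B) = mu B.

Definition ergodic_measure (T : X -> X) (mu : probability X R) : Prop :=
  invariant_measure T mu /\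
  forall B : set X, measurable B -> T @^-1` B = B -> mu B = 0 \/ mu B = 1.

End dynamics.

Lemma continuous_reindex (I J : eqType) (V : topologicalType) (h : J -> I) :
  continuous (fun a : {ptws I -> V} => (fun j => a (h j)) : {ptws J -> V}).
Proof.
move=> x.
have FF : Filter
    ((fun a : {ptws I -> V} => (fun j => a (h j)) : {ptws J -> V}) @ x).
  by apply: fmap_filter; exact: nbhs_filter.
apply/cvg_sup => j.
have cj := @proj_continuous I (fun=> V) (h j) x.
apply/cvg_image; first by apply/seteqP; split=> // y _; exists (fun=> y).
move=> P nP; exists ((fun a : {ptws J -> V} => a j) @^-1` P); first exact: cj nP.
by apply/seteqP; split=> [_ [a Pa <-]//|v Pv]; exists (fun=> v).
Qed.

Section cellular_automaton.
Variable A : finGroupType.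

Definition shift_map (a : config nat A) : config nat A := fun n => a n.+1.

Definition mulCA (a : config nat A) : config nat A :=
  fun n => ((a n : A) * (a n.+1 : A))%g.

Definition restrict_pos (a : config nat A) : config posnat A :=
  fun n => a (val n).

Lemma continuous_restrict_pos : continuous restrict_pos.
Proof. exact: (@continuous_reindex nat posnat (alphabet A) val). Qed.

Lemma measurable_restrict_pos : measurable_fun setT restrict_pos.
Proof.
apply: (@measurability _ _ _ _ setT restrict_pos (@open (config posnat A))).
  by [].
move=> _ [B oB <-]; rewrite setTI; apply: sub_sigma_algebra.
by have /continuousP := continuous_restrict_pos; exact.
Qed.

HB.instance Definition _ :=
  isMeasurableFun.Build _ _ _ _ restrict_pos measurable_restrict_pos.

End cellular_automaton.

Section conditional_measures.
Variables (R : realType) (A : finGroupType).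

Definition proj_pos (mu : probability (config nat A) R) :
    probability (config posnat A) R :=
  distribution mu (@restrict_pos A).

(* k is a version of the conditional law of x_0 given the restriction of x to
   the positive integers; any two versions agree proj_pos mu-a.e. *)
Definition is_conditional (mu : probability (config nat A) R)
    (k : R.-pker (config posnat A) ~> (alphabet A)) : Prop :=
  forall (b : alphabet A) (E : set (config posnat A)), measurable E ->
    mu [set x | x 0%N = b /\ E (restrict_pos x)] =
    \int[proj_pos mu]_(a in E) k a [set b].

(* The support of a measure on a finite discrete space is the set of its
   atoms. *)
Definition mass_support (m : set (alphabet A) -> \bar R) : {set A} :=
  finset (fun c : A => m [set (c : alphabet A)] != 0).

(* (C :* b)%g is the right coset {c b | c in C}. *)
Definition coset_measure (C : {group A}) (mu : probability (config nat A) R) :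
    Prop :=
  exists2 k : R.-pker (config posnat A) ~> (alphabet A),
    is_conditional mu k &
    {ae proj_pos mu, forall a, exists b : A,
      mass_support (k a) = (C :* b)%g /\
      forall c : A, c \in (C :* b)%g ->
        k a [set (c : alphabet A)] = ((#|C|%:R)^-1)%:E}.

End conditional_measures.

(* Main.v *)
From HB Require Import structures.
Require Import Defs.
From mathcomp Require Import all_boot all_order all_algebra all_fingroup.
From mathcomp Require Import all_classical all_reals all_analysis.
From mathcomp Require Import measurable_realfun ring.

(** Write x~ for the restriction of a configuration x to the positive
    coordinates, Phi for the multiplication automaton, and F_b(x~) for the
    conditional probability that x_0 = b given x~.

    Since (Phi x)_0 = x_0 x_1, the conditional law of (Phi x)_0 given x~ is the
    conditional law of x_0 translated on the right by x_1.  On the other hand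
    (Phi x)~ is a function of x~, so the conditional law of (Phi x)_0 given
    (Phi x)~ is obtained from the former by a further conditioning.
    Conditioning shrinks the L^2 norm, but Phi preserves mu, so both families of
    conditional probabilities have the same total L^2 norm and no shrinking
    takes place: the two laws agree, that is F_(b x_1)((Phi x)~) = F_b(x~)
    almost surely ([density_mulCA_ae]).

    Consequently, for each c in the group, the function
    v_c(x) = F_(c x_0)(x~) satisfies v_c (Phi x) = F_(c x_0 x_1)((Phi x)~)
    = v_c(x) almost surely, and ergodicity makes it a constant p(c).  Read on
    the fibres of x -> x~, this says that for almost every tail y, every b
    charged by the conditional law at y and every c, F_(cb)(y) = p(c)
    ([translated_density_const]).

    It remains to do group theory with one such weight F_.(y)
    ([translation_rigid_weights]): the set C of all c with p(c) != 0 is closed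
    under products, p is constant on C, and the weight is p transported to the
    right coset C b. *)

Set Implicit Arguments.
Unset Strict Implicit.
Unset Printing Implicit Defensive.

Import Order.TTheory GRing.Theory Num.Theory.
Import numFieldNormedType.Exports.

Local Open Scope classical_set_scope.
Local Open Scope ring_scope.

(** * Measurability on configuration spaces *)

Lemma continuous_ptws (X V : topologicalType) (J : eqType)
    (f : X -> {ptws J -> V}) :
  (forall j, continuous (fun x => f x j)) -> continuous f.
Proof.
move=> cf x; have FF : Filter (f @ x).
  by apply: fmap_filter; exact: nbhs_filter.
apply/cvg_sup => j; apply/cvg_image.
  by apply/seteqP; split=> // y _; exists (fun=> y).
move=> P Px; exists ((fun a : {ptws J -> V} => a j) @^-1` P).
  exact: cf Px.
by apply/seteqP; split=> [_ [a Pa <-]//|v Pv]; exists (fun=> v).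
Qed.

Lemma measurable_fun_select d d' (X : measurableType d) (Y : measurableType d')
    (I : finType) (s : X -> I) (G : I -> X -> Y) :
  (forall i, measurable (s @^-1` [set i])) ->
  (forall i, measurable_fun setT (G i)) ->
  measurable_fun setT (fun x => G (s x) x).
Proof.
move=> ms mG _ B mB; rewrite setTI.
have -> : (fun x => G (s x) x) @^-1` B =
    \bigcup_(i in [set: I]) (s @^-1` [set i] `&` G i @^-1` B).
  apply/seteqP; split=> [x Bx|x [i _ [/= <-]]//].
  by exists (s x).
apply: fin_bigcup_measurable => // i _.
by apply: measurableI => //; rewrite -[X in measurable X]setTI; exact: mG.
Qed.

Section configurations.
Variable A : finGroupType.

Lemma continuous_config_measurable (I J : Type)
    (f : config I A -> config J A) :
  continuous f -> measurable_fun setT f.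
Proof.
move=> /continuousP cf.
apply: (@measurability _ _ _ _ setT f (@open (config J A))) => //.
by move=> _ [B oB <-]; rewrite setTI; apply: sub_sigma_algebra; exact: cf.
Qed.

Lemma near_coordinate (I : eqType) (n : I) (x : config I A) :
  \forall y \near x, y n = x n.
Proof.
by have := @proj_continuous I (fun=> alphabet A) n x [set x n]; apply.
Qed.

Lemma measurable_coordinate (I : eqType) (n : I) (b : A) :
  measurable ((fun x : config I A => x n : A) @^-1` [set b]).
Proof.
apply: sub_sigma_algebra; rewrite openE => x /= xb.
rewrite /interior /=; apply: filterS (near_coordinate n x) => y /= ->.
exact: xb.
Qed.

Lemma measurable_fun_at d' (Y : measurableType d') (I : eqType) (n : I)
    (G : A -> config I A -> Y) :
  (forall b, measurable_fun setT (G b)) ->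
  measurable_fun setT (fun x : config I A => G (x n) x).
Proof.
apply: (measurable_fun_select (s := fun x : config I A => x n : A)) => b.
exact: measurable_coordinate.
Qed.

(** The common form of the automaton on all of [config nat A], where [s] is the
    successor, and of its action on the tails in [config posnat A]. *)
Definition local_mul (J : Type) (s : J -> J) (a : config J A) : config J A :=
  fun j => ((a j : A) * (a (s j) : A))%g.

Lemma measurable_local_mul (J : eqType) (s : J -> J) :
  measurable_fun setT (local_mul s).
Proof.
apply: continuous_config_measurable; apply: continuous_ptws => j x P /= Px.
have n1 := near_coordinate j x; have n2 := near_coordinate (s j) x.
apply: filterS2 n1 n2 => y /= y1 y2.
by rewrite /local_mul /= y1 y2; exact: nbhs_singleton Px.
Qed.

End configurations.

(** * Disintegration over a finite label *)

Section almost_everywhere_lemmas.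
Context d (X : measurableType d) (R : realType).

Lemma ae_imp (mu : {measure set X -> \bar R}) (P Q : X -> Prop) :
  (forall x, P x -> Q x) ->
  {ae mu, forall x, P x} -> {ae mu, forall x, Q x}.
Proof. by move=> PQ; apply: filterS. Qed.

Lemma ae_exists (P : probability X R) (Q : X -> Prop) :
  {ae P, forall x, Q x} -> exists x, Q x.
Proof.
move=> [N [mN N0 QN]]; apply: contrapT => nQ.
have : P N = 1%E.
  rewrite (_ : N = setT); first exact: probability_setT.
  by apply/seteqP; split=> // x _; apply: QN => Qx; apply: nQ; exists x.
by rewrite N0 => /eqP; rewrite eqe eq_sym oner_eq0.
Qed.

Lemma ge0_integral_eq0_ae (mu : {measure set X -> \bar R}) (f : X -> R) :
  (forall x, 0 <= f x) -> measurable_fun setT f ->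
  (\int[mu]_x (f x)%:E = 0)%E -> {ae mu, forall x, f x = 0}.
Proof.
move=> f0 mf f_eq0.
have mEf : measurable_fun setT (EFin \o f) by exact/measurable_EFinP.
have abs0 : (\int[mu]_x `|(EFin \o f) x| = 0)%E.
  rewrite -[X in _ = X]f_eq0; apply: eq_integral => x _.
  by rewrite gee0_abs// lee_fin.
have := (ae_eq_integral_abs mu measurableT mEf).1 abs0.
by apply: filterS => x /(_ Logic.I) [].
Qed.

End almost_everywhere_lemmas.

Section fibers.
Context d (X : measurableType d) (R : realType) (mu : {measure set X -> \bar R}).
Variables (I : finType) (s : X -> I).
Hypothesis ms : forall i, measurable (s @^-1` [set i]).

Lemma ge0_integral_fibers (f : X -> \bar R) :
  measurable_fun setT f -> (forall x, 0 <= f x)%E ->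
  (\int[mu]_x f x = \sum_i \int[mu]_(x in s @^-1` [set i]) f x)%E.
Proof.
move=> mf f0.
have XE : \big[setU/set0]_(i <- index_enum I) (s @^-1` [set i]) = [set: X].
  rewrite -bigcup_seq; apply/seteqP; split=> // x _.
  by exists (s x) => //=; rewrite mem_index_enum.
rewrite -[in LHS]XE ge0_integral_bigsetU ?index_enum_uniq ?XE//.
by move=> i j _ _ [x [/= <- <-]].
Qed.

Lemma measure_fibers (B : set X) : measurable B ->
  mu B = (\sum_i mu (B `&` s @^-1` [set i]))%E.
Proof.
move=> mB; rewrite -{1}(setIT B) -integral_indic//.
rewrite ge0_integral_fibers//.
- by apply: eq_bigr => i _; rewrite integral_indic.
- by apply/measurable_EFinP; exact: measurable_indic.
Qed.

End fibers.

Section label_law.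
Context d d' (X : measurableType d) (Y : measurableType d') (R : realType).
Variables (P : probability X R) (I : finType) (s : X -> I).
Hypothesis ms : forall i, measurable (s @^-1` [set i]).
Variable pi : {mfun X >-> Y}.

Let Pfin i : (P (s @^-1` [set i]) < +oo)%E.
Proof. by rewrite ltey_eq fin_num_measure. Qed.

(** The joint law of the event [s = i] and of [pi], as a measure in [pi]; its
    density against the law of [pi] is the conditional probability of [s = i]. *)
Definition label_law (i : I) : set Y -> \bar R :=
  pushforward (mfrestr (ms i) (Pfin i)) pi.

Let label_law0 i : label_law i set0 = 0%E.
Proof. exact: measure0. Qed.

Let label_law_ge0 i E : (0 <= label_law i E)%E.
Proof. exact: measure_ge0. Qed.

Let label_law_sigma_additive i : semi_sigma_additive (label_law i).
Proof. exact: measure_semi_sigma_additive. Qed.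

HB.instance Definition _ i := isMeasure.Build _ _ _ (label_law i)
  (label_law0 i) (label_law_ge0 i) (@label_law_sigma_additive i).

Let label_law_fin i : fin_num_fun (label_law i).
Proof.
move=> U mU; apply: fin_num_measure; rewrite -[X in measurable X]setTI.
exact: (measurable_funPT pi).
Qed.

HB.instance Definition _ i :=
  Measure_isFinite.Build _ _ _ (label_law i) (label_law_fin i).

Lemma label_lawE i E : label_law i E = P (pi @^-1` E `&` s @^-1` [set i]).
Proof. by []. Qed.

Lemma dominates_label_law i : label_law i `<< distribution P pi.
Proof.
apply/null_content_dominatesP => E mE; rewrite /distribution/= => PE0.
rewrite label_lawE; have mpiE : measurable (pi @^-1` E).
  by rewrite -[X in measurable X]setTI; exact: (measurable_funPT pi).
by apply: (subset_measure0 _ mpiE) => //; exact: measurableI.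
Qed.

Lemma ge0_integral_label_law i (h : Y -> R) :
  (forall y, 0 <= h y) -> measurable_fun setT h ->
  (\int[label_law i]_y (h y)%:E = \int[P]_(x in s @^-1` [set i]) (h (pi x))%:E)%E.
Proof.
move=> h0 mh.
have mhpi : measurable_fun [set: X] (EFin \o (h \o pi)).
  by apply/measurable_EFinP; apply: measurableT_comp.
rewrite /label_law ge0_integral_pushforward//; last 2 first.
- exact/measurable_EFinP.
- by move=> y _; rewrite lee_fin.
rewrite preimage_setT.
rewrite (@ge0_negligible_integral _ _ _ _ _ (~` (s @^-1` [set i])))//=; last 3 first.
- exact: measurableC.
- by move=> x _; rewrite lee_fin.
- by rewrite /mfrestr /mrestr setICl measure0.
rewrite setTD setCK; apply: eq_measure_integral => B mB sB.
by rewrite /=/mfrestr/mrestr setIidl.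
Qed.

End label_law.

(** The density of [label_law i] gives the conditional probability of the label
    [i] only almost everywhere.  Where the densities fail to sum to one they
    are replaced by the point mass at [i0], so that the weights [F] form a
    probability at every point and define a kernel. *)
Lemma disintegration d d' (X : measurableType d) (Y : measurableType d')
    (R : realType) (P : probability X R) (I : finType) (i0 : I) (s : X -> I)
    (pi : {mfun X >-> Y}) :
  (forall i, measurable (s @^-1` [set i])) ->
  exists F : I -> Y -> R, [/\
    forall i, measurable_fun setT (F i),
    forall i y, 0 <= F i y,
    forall y, \sum_i F i y = 1 &
    forall H : I -> Y -> R, (forall i y, 0 <= H i y) ->
      (forall i, measurable_fun setT (H i)) ->
      (\int[P]_x (H (s x) (pi x))%:E =
       \int[P]_x (\sum_i F i (pi x) * H i (pi x))%:E)%E].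
Proof.
move=> ms; pose mu : probability Y R := distribution P pi.
pose g i := Radon_Nikodym_SigmaFinite.f (label_law P ms pi i) mu.
have dom i : label_law P ms pi i `<< mu by exact: dominates_label_law.
have g0 i y : (0 <= g i y)%E by exact: (Radon_Nikodym_SigmaFinite.f_ge0 (dom i)).
have gfin i y : g i y \is a fin_num.
  exact: (Radon_Nikodym_SigmaFinite.f_fin_num (dom i)).
have mg i : measurable_fun setT (g i).
  exact: measurable_int (Radon_Nikodym_SigmaFinite.f_integrable (dom i)).
pose S y := (\sum_i g i y)%E.
have mS : measurable_fun setT S by exact: emeasurable_sum.
have S1 : ae_eq mu setT S (cst 1%E).
  apply/ae_eq_sym/integral_ae_eq => //.
    exact: finite_measure_integrable_cst.
  move=> E _ mE; rewrite integral_cst// mul1e.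
  rewrite ge0_integral_sum//; last by move=> i; exact: measurable_funTS.
  transitivity (\sum_i P (pi @^-1` E `&` s @^-1` [set i]))%E.
    apply: (measure_fibers P ms) => //; rewrite -[X in measurable X]setTI.
    exact: (measurable_funPT pi).
  apply: eq_bigr => i _; rewrite -label_lawE.
  exact: (Radon_Nikodym_SigmaFinite.f_integral (dom i)).
pose F i y := if S y == 1%E then fine (g i y) else (i == i0)%:R.
have Fg i : ae_eq mu setT (EFin \o F i) (g i).
  apply: filterS S1 => y /(_ Logic.I) Sy _.
  by rewrite /= /F Sy eqxx fineK.
have mF i : measurable_fun setT (F i).
  apply: measurable_fun_ifT => //.
    exact: measurable_fun_eqe.
  exact: (measurableT_comp (fine_measurable measurableT)).
have F0 i y : 0 <= F i y by rewrite /F; case: ifP => _; [exact: fine_ge0|].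
exists F; split => //.
  move=> y; rewrite /F; case: eqP => [Sy|_].
    by apply: EFin_inj; rewrite -sumEFin -Sy; apply: eq_bigr => i _; rewrite fineK.
  by rewrite -natr_sum (bigD1 i0)//= eqxx big1// => i /negbTE ->.
move=> H H0 mH.
have mHpi i : measurable_fun setT (fun x => (H i (pi x))%:E).
  by apply/measurable_EFinP; exact: measurableT_comp.
rewrite (ge0_integral_fibers P ms); last 2 first.
- by apply: (@measurable_fun_select _ _ _ _ _ s (fun i x => (H i (pi x))%:E)).
- by move=> x; rewrite lee_fin.
under [RHS]eq_integral do rewrite -sumEFin.
rewrite ge0_integral_sum//; last 2 first.
- move=> i; apply/measurable_EFinP; apply: measurable_funM => //.
    exact: measurableT_comp.
  exact: measurableT_comp.
- by move=> i x _; rewrite lee_fin mulr_ge0.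
apply: eq_bigr => i _.
transitivity (\int[P]_(x in s @^-1` [set i]) (H i (pi x))%:E)%E.
  by apply: eq_integral => x; rewrite inE/= => ->.
have := H0 i; have := mH i; move: (H i) => h mh h0.
rewrite -(ge0_integral_label_law P ms)//.
transitivity (\int[mu]_y ((h y)%:E * g i y))%E.
  rewrite (Radon_Nikodym_SigmaFinite.change_of_variables (dom i))//.
  by move/measurable_EFinP : mh.
transitivity (\int[mu]_y ((F i y * h y)%:E))%E.
  apply: ge0_ae_eq_integral => //.
  - apply: emeasurable_funM => //; exact/measurable_EFinP.
  - by apply/measurable_EFinP; exact: measurable_funM.
  - by move=> y _; rewrite mule_ge0// lee_fin.
  - by move=> y _; rewrite lee_fin mulr_ge0.
  - apply: filterS (Fg i) => y /(_ Logic.I) /= Fy _.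
    by rewrite EFinM Fy muleC.
rewrite ge0_integral_distribution//.
- by apply/measurable_EFinP; exact: measurable_funM.
- by move=> y; rewrite lee_fin mulr_ge0.
Qed.

Section mixture_kernel.
Context d d' (Y : measurableType d) (Z : measurableType d') (R : realType).
Variables (I : finType) (i0 : I) (z : I -> Z) (F : I -> Y -> R).
Hypothesis F0 : forall i y, 0 <= F i y.

(** The kernel sending [y] to the sum of the point masses at [z i] with weights
    [F i y].  The finite sum of measures is indexed by the ranks of the labels,
    and [i0] pads their enumeration.  The proofs [F1] and [mF] are arguments so
    that the probability kernel structure can be inferred from the term. *)
Definition mixture (F1 : forall y, \sum_i F i y = 1)
    (mF : forall i, measurable_fun setT (F i)) (y : Y) :
    {measure set Z -> \bar R} :=
  msum (fun n => mscale (NngNum (F0 (nth i0 (enum I) n) y))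
                        \d_(z (nth i0 (enum I) n))) #|I|.

Hypothesis F1 : forall y, \sum_i F i y = 1.
Hypothesis mF : forall i, measurable_fun setT (F i).
Local Notation k := (mixture F1 mF).

Lemma mixtureE y U : k y U = (\sum_i (F i y)%:E * \d_(z i) U)%E.
Proof.
rewrite /mixture /= /msum /mscale /=.
by rewrite -[RHS]big_enum /= [RHS](big_nth i0) big_mkord -cardE.
Qed.

Let measurable_mixture U : measurable U -> measurable_fun setT (k ^~ U).
Proof.
move=> mU; under eq_fun do rewrite mixtureE.
apply: emeasurable_sum => i; apply: emeasurable_funM => //.
exact/measurable_EFinP.
Qed.

HB.instance Definition _ :=
  isKernel.Build _ _ _ _ _ k measurable_mixture.

Let mixture1 y : k y setT = 1%E.
Proof.
rewrite mixtureE -[1%E]/((1 : R)%:E) -(F1 y) -sumEFin.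
by apply: eq_bigr => i _; rewrite diracT mule1.
Qed.

HB.instance Definition _ :=
  Kernel_isProbability.Build _ _ _ _ _ k mixture1.

End mixture_kernel.

(** * Ergodicity and almost invariant functions *)

Section ergodic.
Context d (X : measurableType d) (R : realType).
Variables (T : X -> X) (mu : probability X R).
Hypotheses (mT : measurable_fun setT T) (Tmu : invariant_measure T mu).

Lemma ae_comp_invariant (Q : X -> Prop) :
  {ae mu, forall x, Q x} -> {ae mu, forall x, Q (T x)}.
Proof.
move=> [N [mN N0 QN]]; exists (T @^-1` N); split.
- by rewrite -[X in measurable X]setTI; exact: mT.
- by rewrite Tmu.
- by move=> x /= nQ; apply: QN.
Qed.

Lemma ge0_integral_invariant (f : X -> \bar R) :
  measurable_fun setT f -> (forall x, 0 <= f x)%E ->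
  (\int[mu]_x f (T x) = \int[mu]_x f x)%E.
Proof.
move=> mf f0; rewrite -(@ge0_integral_pushforward _ _ _ _ _ _ mT _ setT)//.
by apply: eq_measure_integral => B mB _; exact: Tmu.
Qed.

Lemma measurable_iter n : measurable_fun setT (iter n T).
Proof.
elim: n => [|n IH]; first exact: measurable_id.
by rewrite (_ : iter n.+1 T = T \o iter n T)//; exact: measurableT_comp.
Qed.

(** Ergodicity is about sets equal to their preimage, whereas the level set
    [q < v] is invariant only up to a null set.  The set of the points whose
    orbit visits it infinitely often is strictly invariant, and differs from it
    by a null set because [v] is almost surely constant along orbits. *)
Lemma ergodic_ae_le_or_gt (v : X -> R) (q : R) :
  ergodic_measure T mu -> measurable_fun setT v ->
  {ae mu, forall x, v (T x) = v x} ->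
  {ae mu, forall x, v x <= q} \/ {ae mu, forall x, q < v x}.
Proof.
move=> [_ ergT] mv vT.
have vTn : {ae mu, forall x, forall n, v (iter n T x) = v x}.
  apply: ae_foralln; elim=> [|n IH]; first exact: aeW.
  apply: filterS2 vT (ae_comp_invariant IH) => x vx.
  by rewrite -iterSr vx.
pose B := \bigcap_n \bigcup_(m in [set m | (n <= m)%N])
  (v \o iter m T) @^-1` `]q, +oo[.
have BE x : (forall n, v (iter n T x) = v x) -> B x <-> q < v x.
  move=> vx; split=> [/(_ 0%N Logic.I) [m _ /=]|qv n _].
    by rewrite in_itv/= andbT vx.
  by exists n => //=; rewrite in_itv/= andbT vx.
have mB : measurable B.
  apply: bigcapT_measurable => n; apply: bigcup_measurable => m _.
  rewrite -[X in measurable X]setTI.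
  exact: (measurableT_comp mv (measurable_iter m)).
have TB : T @^-1` B = B.
  apply/seteqP; split=> x Bx n _.
    have [m /= nm] := Bx n Logic.I; rewrite -iterSr => qv.
    by exists m.+1 => //=; exact: leqW.
  have [[//|m] /= nm qv] := Bx n.+1 Logic.I.
  by exists m => //=; rewrite -iterSr.
have [B0|B1] := ergT B mB TB; [left|right].
- have nB : {ae mu, forall x, ~ B x}.
    by exists B; split => // x /=; exact: contrapT.
  apply: filterS2 vTn nB => x /BE Bx nBx.
  by rewrite leNgt; apply/negP => /Bx.
- have aeB : {ae mu, forall x, B x}.
    exists (~` B); split => //; first exact: measurableC.
    by rewrite probability_setC// B1 subee.
  by apply: filterS2 vTn aeB => x /BE Bx /Bx.
Qed.

(** The constant is the mean [m] of [v]: almost surely [v] stays on one side of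
    [m], so that [v - m] has a constant sign and integral zero. *)
Lemma ergodic_ae_constant (v : X -> R) (M : R) :
  ergodic_measure T mu -> measurable_fun setT v ->
  (forall x, 0 <= v x <= M) -> {ae mu, forall x, v (T x) = v x} ->
  exists c, {ae mu, forall x, v x = c}.
Proof.
move=> ergT mv v0M vT.
have iv : mu.-integrable setT (EFin \o v).
  apply: (measurable_bounded_integrable measurableT _ mv).
    by rewrite ltey_eq fin_num_measure.
  exists M; split; first exact: num_real.
  move=> y My x _ /=; have /andP[v0 vM] := v0M x.
  by rewrite ger0_norm// (le_trans vM)// ltW.
pose m := fine (\int[mu]_x (v x)%:E)%E.
have mE : (\int[mu]_x (v x)%:E = m%:E)%E by rewrite fineK// integrable_fin_num.
have ic : mu.-integrable setT (EFin \o cst m) by exact: finite_measure_integrable_cst.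
have cE : (\int[mu]_x m%:E = m%:E)%E.
  by rewrite integral_cst//= [X in (_ * X)%E](_ : _ = 1%E) ?mule1//; exact: probability_setT.
have mvm : measurable_fun setT (fun x => (v x - m)%:E).
  by apply/measurable_EFinP; exact: measurable_funB.
exists m.
suff : (\int[mu]_x `|(v x - m)%:E| = 0)%E.
  move/(ae_eq_integral_abs mu measurableT mvm); apply: filterS => x /(_ Logic.I)/=.
  by move=> [/eqP]; rewrite subr_eq0 => /eqP.
have mabs : measurable_fun setT (fun x => `|(v x - m)%:E|%E).
  exact: measurableT_comp.
have mmv : measurable_fun setT (fun x => (m - v x)%:E).
  by apply/measurable_EFinP; exact: measurable_funB.
have [vm|vm] := ergodic_ae_le_or_gt m ergT mv vT.
- transitivity (\int[mu]_x (m - v x)%:E)%E.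
    apply: ae_eq_integral => //; apply: filterS vm => x vm _ /=.
    by rewrite distrC ger0_norm// subr_ge0.
  under eq_integral do rewrite EFinB.
  by rewrite (integralB _ ic iv)// cE mE subee.
- transitivity (\int[mu]_x (v x - m)%:E)%E.
    apply: ae_eq_integral => //; apply: filterS vm => x vm _ /=.
    by rewrite ger0_norm// subr_ge0 ltW.
  under eq_integral do rewrite EFinB.
  by rewrite (integralB _ iv ic)// cE mE subee.
Qed.

End ergodic.

(** * The conditional law of the zeroth coordinate *)

Definition pos_succ (n : posnat) : posnat := exist _ (val n).+1 isT.
Definition pos_one : posnat := exist _ 1%N isT.

Section conditional_law.
Variables (R : realType) (A : finGroupType) (mu : probability (config nat A) R).
Variable F : A -> config posnat A -> R.
Hypothesis mF : forall b, measurable_fun setT (F b).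
Hypothesis F0 : forall b y, 0 <= F b y.
Hypothesis F1 : forall y, \sum_b F b y = 1.
Hypothesis tower : forall H : A -> config posnat A -> R,
  (forall b y, 0 <= H b y) -> (forall b, measurable_fun setT (H b)) ->
  (\int[mu]_x (H (x 0%N) (restrict_pos x))%:E =
   \int[mu]_x (\sum_b F b (restrict_pos x) * H b (restrict_pos x))%:E)%E.

Let F_le1 b y : F b y <= 1.
Proof.
rewrite -(F1 y) (bigD1 b)//= lerDl; apply: sumr_ge0 => i _; exact: F0.
Qed.

Let k : R.-pker (config posnat A) ~> (alphabet A) :=
  mixture (1%g : A) (fun b : A => b : alphabet A) F0 F1 mF.

Lemma mixture_atom y b : k y [set b] = (F b y)%:E.
Proof.
rewrite /k mixtureE (bigD1 b)//= diracE mem_set// mule1.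
rewrite big1 ?adde0// => c cb; rewrite diracE memNset ?mule0//.
by move=> /= cE; rewrite cE eqxx in cb.
Qed.

Lemma mixture_is_conditional : is_conditional mu k.
Proof.
move=> b E mE.
pose B : set (config nat A) := [set x | x 0%N = b /\ E (restrict_pos x)].
rewrite -[X in mu X]/B.
pose H (i : A) (y : config posnat A) : R := (i == b)%:R * \1_E y.
have mH i : measurable_fun setT (H i).
  by apply: measurable_funM => //; exact: measurable_indic.
have H0 i y : 0 <= H i y by rewrite mulr_ge0// indicE.
have HF y : \sum_i F i y * H i y = F b y * \1_E y.
  rewrite (bigD1 b)//= big1 ?addr0 /H ?eqxx ?mul1r// => i /negbTE ->.
  by rewrite mul0r mulr0.
have mB : measurable B.
  apply: (@measurableI _ _ ((fun x : config nat A => x 0%N : A) @^-1` [set b])).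
    exact: measurable_coordinate.
  rewrite -[X in measurable X]setTI; exact: measurable_restrict_pos.
transitivity (\int[mu]_x (H (x 0%N) (restrict_pos x))%:E)%E.
  rewrite -(setIT B) -integral_indic//; apply: eq_integral => x _.
  rewrite /H indicE; congr EFin.
  rewrite indicE -natrM mulnb; congr (_%:R); congr (nat_of_bool _).
  apply/idP/idP => [/set_mem [/= -> Ex]|/andP[/eqP xb /set_mem Ex]].
    by rewrite eqxx mem_set.
  exact: mem_set.
rewrite tower//; under eq_integral do rewrite HF.
under [RHS]eq_integral do rewrite mixture_atom.
rewrite [RHS]integral_mkcond epatch_indic.
have mFE : measurable_fun setT (EFin \o (fun y => F b y * \1_E y)).
  apply/measurable_EFinP; apply: measurable_funM.
    exact: mF.
  exact: measurable_indic.
under [RHS]eq_integral do rewrite -EFinM.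
rewrite (ge0_integral_distribution _ mFE)// => y.
by rewrite lee_fin mulr_ge0// indicE.
Qed.

Hypothesis Phi_mu : invariant_measure (@mulCA A) mu.

Let mr : measurable_fun setT (@restrict_pos A) := @measurable_restrict_pos A.

Let mPhi : measurable_fun setT (@mulCA A).
Proof. exact: (@measurable_local_mul A nat S). Qed.

(** In the notation of the proof, G is the transported density, D the squared
    distance of F and G, Q the squared norm of F and C their scalar product, all
    at the point x.  By the disintegration, the function u(x) = F_(x_0)(x~) has
    the same integral as Q, and u o Phi, which is F_(x_0 x_1)((Phi x)~), has the
    same integral as C.  As Q o Phi is the squared norm of G, invariance gives
    the same integral to Q, C and Q o Phi, so that D = Q + Q o Phi - 2 C has
    integral zero. *)
Lemma density_mulCA_ae :
  {ae mu, forall x, forall b,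
    F (b * x 1%N)%g (restrict_pos (mulCA x)) = F b (restrict_pos x)}.
Proof.
pose r := @restrict_pos A.
pose G b (x : config nat A) := F (b * (x 1%N : A))%g (r (mulCA x)).
pose Q x := \sum_b F b (r x) ^+ 2.
pose C x := \sum_b F b (r x) * G b x.
pose D x := \sum_b (F b (r x) - G b x) ^+ 2.
have mFr b : measurable_fun setT (fun x => F b (r x)) by exact: measurableT_comp.
have mG b : measurable_fun setT (G b).
  apply: (@measurable_fun_at _ _ _ _ 1%N
    (fun d x => F (b * d)%g (r (mulCA x)))) => d.
  by apply: (measurableT_comp (mF _)); exact: measurableT_comp.
have mQ : measurable_fun setT Q.
  by apply: measurable_sum => b; exact: measurable_funX.
have mC : measurable_fun setT C.
  by apply: measurable_sum => b; exact: measurable_funM.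
have mD : measurable_fun setT D.
  by apply: measurable_sum => b; apply: measurable_funX; exact: measurable_funB.
have Q0 x : 0 <= Q x by apply: sumr_ge0 => b _; exact: sqr_ge0.
have D0 x : 0 <= D x by apply: sumr_ge0 => b _; exact: sqr_ge0.
have C0 x : 0 <= C x by apply: sumr_ge0 => b _; rewrite mulr_ge0 ?F0.
have QE x : Q (mulCA x) = \sum_b G b x ^+ 2.
  by rewrite /Q (reindex_inj (mulIg (x 1%N : A))).
have expand x : D x + (C x + C x) = Q x + Q (mulCA x).
  rewrite QE /D /C /Q -!big_split/=; apply: eq_bigr => b _; ring.
have EC : (\int[mu]_x (C x)%:E = \int[mu]_x (Q x)%:E)%E.
  transitivity (\int[mu]_x (F (mulCA x 0%N) (r (mulCA x)))%:E)%E.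
    (* Phi acts on the tails by [local_mul pos_succ], up to conversion. *)
    rewrite (@tower (fun b y => F (b * (y pos_one : A))%g (local_mul pos_succ y)))//.
    move=> b; apply: (@measurable_fun_at _ _ _ _ pos_one
      (fun d y => F (b * d)%g (local_mul pos_succ y))) => d.
    by apply: (measurableT_comp (mF _)); exact: measurable_local_mul.
  rewrite (@ge0_integral_invariant _ _ _ _ _ mPhi Phi_mu
    (fun x => (F (x 0%N) (r x))%:E)).
  - exact: (@tower F).
  - apply/measurable_EFinP.
    exact: (@measurable_fun_at _ _ _ _ 0%N (fun b x => F b (r x))).
  - by move=> x; rewrite lee_fin.
have EQ : (\int[mu]_x (Q (mulCA x))%:E = \int[mu]_x (Q x)%:E)%E.
  apply: (@ge0_integral_invariant _ _ _ _ _ mPhi Phi_mu (EFin \o Q)).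
    exact/measurable_EFinP.
  by move=> x; rewrite lee_fin.
have fQ : (\int[mu]_x (Q x)%:E)%E \is a fin_num.
  apply: integrable_fin_num => //.
  apply: (measurable_bounded_integrable measurableT _ mQ).
    by rewrite ltey_eq fin_num_measure.
  exists 1; split; first exact: num_real.
  move=> M M1 x _ /=; rewrite ger0_norm// (le_trans _ (ltW M1))//.
  rewrite -(F1 (r x)); apply: ler_sum => b _.
  by rewrite expr2 ler_piMl.
have ED : (\int[mu]_x (D x)%:E = 0)%E.
  have : (\int[mu]_x (D x + (C x + C x))%:E =
          \int[mu]_x (Q x + Q (mulCA x))%:E)%E.
    by apply: eq_integral => x _; rewrite expand.
  under eq_integral do rewrite !EFinD.
  under [RHS]eq_integral do rewrite EFinD.
  have mEC : measurable_fun setT (EFin \o C) by exact/measurable_EFinP.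
  have mEQ : measurable_fun setT (fun x => (Q (mulCA x))%:E).
    by apply/measurable_EFinP; exact: measurableT_comp.
  rewrite !ge0_integralD//; try by [exact: emeasurable_funD|
    move=> x _; rewrite ?adde_ge0 ?lee_fin | exact/measurable_EFinP].
  rewrite EC EQ => h.
  rewrite -[LHS](@addeK _ (\int[mu]_x (Q x)%:E + \int[mu]_x (Q x)%:E)%E).
    by rewrite h subee// fin_numD fQ.
  by rewrite fin_numD fQ.
apply: filterS (ge0_integral_eq0_ae D0 mD ED) => x Dx b.
have /psumr_eq0P : \sum_b (F b (r x) - G b x) ^+ 2 = 0 := Dx.
move=> /(_ (fun _ _ => sqr_ge0 _) b isT) /eqP.
by rewrite sqrf_eq0 subr_eq0 => /eqP ->.
Qed.

Hypothesis Phi_ergodic : ergodic_measure (@mulCA A) mu.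

(** That v_c equals p(c) for almost every x turns into a statement about all the
    atoms b of the conditional law, because the total deviation H_b of the
    F_(cb) from the p(c), taken at b = x_0 and integrated, is the integral of
    the sum of the F_b H_b. *)
Lemma translated_density_const : exists p : A -> R,
  {ae proj_pos mu, forall y, forall b c, F b y != 0 -> F (c * b)%g y = p c}.
Proof.
pose v c (x : config nat A) := F (c * (x 0%N : A))%g (restrict_pos x).
have mv c : measurable_fun setT (v c).
  apply: (@measurable_fun_at _ _ _ _ 0%N
    (fun b x => F (c * b)%g (restrict_pos x))) => b.
  exact: (measurableT_comp (mF _)).
have v01 c x : 0 <= v c x <= 1 by rewrite F0 F_le1.
have vPhi c : {ae mu, forall x, v c (mulCA x) = v c x}.
  apply: ae_imp density_mulCA_ae => x Fx.
  by rewrite /v -Fx /mulCA mulgA.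
have [p vp] := choice (fun c =>
  ergodic_ae_constant mPhi Phi_mu Phi_ergodic (mv c) (v01 c) (vPhi c)).
exists p.
pose H b y := \sum_c `|F (c * b)%g y - p c|.
have H0 b y : 0 <= H b y by apply: sumr_ge0 => c _; exact: normr_ge0.
have mH b : measurable_fun setT (H b).
  apply: measurable_sum => c; apply: measurableT_comp => //.
  exact: measurable_funB.
(* The finitely many almost sure equalities are enumerated by the naturals. *)
have vp_all : {ae mu, forall x, forall c, v c x = p c}.
  have : {ae mu, forall x, forall n, v (nth 1%g (enum A) n) x = p (nth 1%g (enum A) n)}.
    by apply: ae_foralln => n; exact: vp.
  apply: ae_imp => x vx c; have := vx (index c (enum A)).
  by rewrite nth_index// mem_enum.
pose K y := \sum_b F b y * H b y.
have K0 y : 0 <= K y by apply: sumr_ge0 => b _; rewrite mulr_ge0.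
have mK : measurable_fun setT K.
  by apply: measurable_sum => b; exact: measurable_funM.
have intK : (\int[proj_pos mu]_y (K y)%:E = 0)%E.
  have mEK : measurable_fun setT (EFin \o K) by exact/measurable_EFinP.
  rewrite (ge0_integral_distribution _ mEK); last by move=> y; rewrite lee_fin.
  rewrite -(tower H0 mH) -[RHS](integral0 mu setT).
  apply: ae_eq_integral => //.
    apply/measurable_EFinP.
    apply: (@measurable_fun_at _ _ _ _ 0%N (fun b x => H b (restrict_pos x))) => b.
    exact: (measurableT_comp (mH _)).
  apply: ae_imp vp_all => x vx _ /=.
  by rewrite /H big1// => c _; rewrite -vx subrr normr0.
apply: ae_imp (ge0_integral_eq0_ae K0 mK intK) => y Ky b c Fb.
have /psumr_eq0P : \sum_b F b y * H b y = 0 := Ky.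
have FH0 i : 0 <= F i y * H i y by rewrite mulr_ge0.
move=> /(_ (fun i _ => FH0 i) b isT) /eqP.
rewrite mulf_eq0 (negbTE Fb)/= => /eqP /psumr_eq0P.
move=> /(_ (fun _ _ => normr_ge0 _) c isT) /eqP.
by rewrite normr_eq0 subr_eq0 => /eqP.
Qed.

End conditional_law.

(** * Weights on a group with constant translates *)

(** If [c] and [d] lie in the support of [p] and [b] in that of the weight [f],
    then [d b] lies in the support of [f] too, and evaluating [f] at [c d b]
    from [b] and from [d b] gives [p (c d) = p c].  Hence the support of [p] is
    a group on which [p] is constant.  The predicate
    [rigid] collects the weights sharing the same [p], so that one group serves
    them all. *)
Lemma translation_rigid_weights (R : numFieldType) (A : finGroupType)
    (p : A -> R) (rigid : (A -> R) -> Prop) :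
  (forall f, rigid f -> \sum_b f b = 1) ->
  (forall f, rigid f -> forall b c, f b != 0 -> f (c * b)%g = p c) ->
  (exists f, rigid f) ->
  exists C : {group A}, forall f, rigid f -> exists b : A,
    forall c, f c = if c \in (C :* b)%g then (#|C|%:R)^-1 else 0.
Proof.
move=> sum1 rig [f0 rf0].
have some_b f : rigid f -> exists b, f b != 0.
  move=> /sum1 f1; apply: contrapT => /forallNP nf.
  move: f1; rewrite big1 => [/eqP|b _]; first by rewrite eq_sym oner_eq0.
  by apply/eqP/negPn/negP; exact: nf.
have [b0 fb0] := some_b _ rf0; have pE := rig _ rf0.
have p1_neq0 : p 1%g != 0 by rewrite -(pE _ 1%g fb0) mul1g.
have pM c d : p d != 0 -> p (c * d)%g = p c.
  move=> pd; rewrite -(pE b0 (c * d)%g fb0) -mulgA.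
  by rewrite (pE (d * b0)%g)// (pE b0).
pose S : {set A} := [set c | p c != 0]%SET.
have gS : group_set S.
  apply/group_setP; split=> [|c d]; first by rewrite inE.
  by rewrite !inE => pc pd; rewrite pM.
pose C := Group gS.
have pC c : c \in C -> p c = p 1%g.
  by rewrite inE => pc; rewrite -{1}(mul1g c) pM.
have p1E : p 1%g = (#|C|%:R)^-1.
  have : \sum_c p c = 1.
    rewrite -(sum1 _ rf0) [RHS](reindex_inj (mulIg b0)).
    by apply: eq_bigr => c _; rewrite (pE b0).
  rewrite (bigID (mem C))/= [X in _ + X]big1 ?addr0; last first.
    by move=> c; rewrite inE negbK => /eqP.
  under eq_bigr do rewrite pC//.
  rewrite sumr_const => h.
  have C_neq0 : #|C|%:R != 0 :> R by rewrite pnatr_eq0 -lt0n cardG_gt0.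
  by apply: (mulfI C_neq0); rewrite divff// mulr_natl.
exists C => f rf; have [b fb] := some_b _ rf; exists b => c.
have -> : f c = p (c * b^-1)%g by rewrite -(rig _ rf b)// mulgKV.
rewrite mem_rcoset; case: ifPn => [/pC ->//|].
by rewrite inE negbK => /eqP.
Qed.

Theorem theorem11 (R : realType) (A : finGroupType)
    (mu : probability (config nat A) R)
    (mu_shift : invariant_measure (@shift_map A) mu)
    (mu_ergodic : ergodic_measure (@mulCA A) mu) :
  exists C : {group A}, coset_measure C mu.
Proof.
have [F [mF F0 F1 tower]] := disintegration mu (1%g : A) (@restrict_pos A)
  (fun b => measurable_coordinate 0%N b).
have [p pE] := translated_density_const mF F0 F1 tower mu_ergodic.1 mu_ergodic.
pose rigid (f : A -> R) := exists y, f = F ^~ y /\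
  forall b c, F b y != 0 -> F (c * b)%g y = p c.
have [|||C CP] := @translation_rigid_weights R A p rigid.
- by move=> _ [y [-> _]].
- by move=> _ [y [-> ]].
- by have [y yP] := ae_exists pE; exists (F ^~ y), y.
exists C; exists (mixture (1%g : A) (fun b : A => b : alphabet A) F0 F1 mF).
  exact: mixture_is_conditional.
apply: ae_imp pE => y yP.
have [|b Fb] := CP (F ^~ y); first by exists y.
have C_neq0 : (#|C|%:R : R)^-1 != 0.
  by rewrite invr_eq0 pnatr_eq0 -lt0n cardG_gt0.
exists b; split=> [|c cb]; last by rewrite mixture_atom Fb cb.
apply/setP => c; rewrite !inE mixture_atom eqe Fb.
by case: ifP => _; rewrite ?C_neq0 ?eqxx.
Qed.
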